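(* For every convergent $\mathbb{N}^*$-decorated rooted forest $F$, one has $$\bullet_1\sqcup\!\sqcup_1F-(\mathfrak{s}^T)^{-1}\big(\bullet_y\sqcup\!\sqcup_0\,\mathfrak{s}^T(F)\big)\in\mathcal{F}^{\mathrm{conv}}_{\mathbb{N}^*},\qquad \mathfrak{s}^T\big(\bullet_1\sqcup\!\sqcup_1F\big)-\bullet_y\sqcup\!\sqcup_0\,\mathfrak{s}^T(F)\in\mathcal{F}^{\mathrm{conv}}_{\{x,y\}}.$$
   Context: $\mathbb{N}^*=\mathbb{Z}_{\ge1}$. A rooted forest is a finite (possibly empty) disjoint union of finite (non-planar) rooted trees; an $\Omega$-decorated forest carries a map from its vertex set to $\Omega$; forests are taken up to isomorphism. $\mathcal{F}_\Omega$ is the commutative unital $\mathbb{R}$-algebra freely generated by nonempty $\Omega$-decorated rooted trees: product is concatenation (disjoint union), unit is the empty forest $\emptyset$, forests form a basis. $|F|$ is the number of vertices. $\bullet_\omega$ is the one-vertex tree decorated by $\omega$. $B_+^\omega(F)$ is the tree obtained from $F$ by adding a new root decorated by $\omega$ joined to every root of $F$ (extended linearly). A leaf is a vertex without direct successor (child); a branching vertex has strictly more than one direct successor. An $\mathbb{N}^*$-decorated forest is convergent if it is empty or all its roots have decoration $\ge2$; $\mathcal{F}^{\mathrm{conv}}_{\mathbb{N}^*}$ is the linear span of these. A forest in $\mathcal{F}_{\{x,y\}}$ is semiconvergent if all its leaves and branching vertices are decorated by $y$, and convergent if moreover all its roots are decorated by $x$ (the empty forest is both); $\mathcal{F}^{\mathrm{conv}}_{\{x,y\}}$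 is the linear span of convergent forests. The branched binarisation map $\mathfrak{s}^T:\mathcal{F}_{\mathbb{N}^*}\to\mathcal{F}_{\{x,y\}}$ is the unique unital algebra morphism (for concatenation) with $\mathfrak{s}^T(B_+^n(F))=(B_+^x)^{n-1}\big(B_+^y(\mathfrak{s}^T(F))\big)$ for $n\ge1$. It is injective with image the span of semiconvergent forests, on which $(\mathfrak{s}^T)^{-1}$ is defined. $\lambda$-shuffle of trees. For a commutative semigroup $(\Omega,\cdot)$ and $\lambda\in\mathbb{R}$ (for $\lambda=0$, $\Omega$ may be any set), the bilinear product $\sqcup\!\sqcup_\lambda$ on $\mathcal{F}_\Omega$ is defined on forests by recursion on $|F|+|F'|$: (i) $\emptyset\sqcup\!\sqcup_\lambda F=F\sqcup\!\sqcup_\lambda\emptyset=F$; (ii) if $F=T_1\cdots T_k$, $F'=t_1\cdots t_n$ with nonempty trees, $k,n\ge1$, $k+n\ge3$: $F\sqcup\!\sqcup_\lambda F'=\frac1{kn}\sum_{i=1}^k\sum_{j=1}^n(T_i\sqcup\!\sqcup_\lambda t_j)\,T_1\cdots\widehat{T_i}\cdots T_k\,t_1\cdots\widehat{t_j}\cdots t_n$ (hats denote omission); (iii) if $T=B_+^a(f)$, $T'=B_+^{a'}(f')$: $T\sqcup\!\sqcup_\lambda T'=B_+^a(f\sqcup\!\sqcup_\lambda T')+B_+^{a'}(T\sqcup\!\sqcup_\lambda f')+\lambda B_+^{a\cdot a'}(f\sqcup\!\sqcup_\lambda f')$. On $\mathbb{N}^*$ the semigroup law is addition; $\sqcup\!\sqcup_1$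 is the stuffle and $\sqcup\!\sqcup_0$ the shuffle product on trees. *)

(* Defs.v *)
From HB Require Import structures.
From mathcomp Require Import all_boot all_order all_algebra.
From mathcomp Require Import generic_quotient finmap.
From mathcomp Require Import boolp classical_sets functions reals.
From mathcomp Require Import monalg.

Set Implicit Arguments.
Unset Strict Implicit.
Unset Printing Implicit Defensive.

Import GRing.Theory.

Local Open Scope nat_scope.

Inductive ptree (O : Type) : Type := PNode of O & seq (ptree O).

Section PTreeChoice.
Variable O : Type.

Lemma ptree_nested_ind (P : ptree O -> Prop) :
  (forall a s, foldr (fun t => and (P t)) True s -> P (PNode a s)) ->
  forall t, P t.
Proof.
move=> IH; fix self 1 => -[a s]; apply: IH.
elim: s => [|t s IHs]; first exact: I.
by split; [exact: self t | exact: IHs].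
Qed.

Fixpoint ptree_encode (t : ptree O) : GenTree.tree O :=
  let: PNode a s := t in GenTree.Node 0 (GenTree.Leaf a :: map ptree_encode s).

Fixpoint ptree_decode (t : GenTree.tree O) : option (ptree O) :=
  if t is GenTree.Node _ (GenTree.Leaf a :: s)
  then Some (PNode a (pmap ptree_decode s)) else None.

Lemma ptree_encodeK : pcancel ptree_encode ptree_decode.
Proof.
elim/ptree_nested_ind => a s IHs /=; congr (Some (PNode _ _)).
by elim: s IHs => //= t s IHs [-> /IHs] /= ->.
Qed.
End PTreeChoice.

HB.instance Definition _ (O : choiceType) :=
  Choice.copy (ptree O) (pcan_type (@ptree_encodeK O)).

Section All2.
Variables (S T : eqType) (e : S -> T -> bool).

Lemma all2_perm_l x x' y : all2 e x y -> perm_eq x' x ->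
  exists2 y', perm_eq y' y & all2 e x' y'.
Proof.
case: x => [|x0 x]; first by move=> h /perm_nilP->; exists y.
case: y => [//|y0 y]; set s := x0 :: x; set t := y0 :: y => e_st.
have [sz_st st] : size s = size t /\
    forall i, i < size s -> e (nth x0 s i) (nth y0 t i).
  move: e_st; rewrite all2E => /andP[/eqP sz /allP h]; split=> // i lt_i.
  have /h: nth (x0, y0) (zip s t) i \in zip s t.
    by rewrite mem_nth // size_zip -sz minnn.
  by rewrite nth_zip.
move=> /(perm_iotaP x0)[Is pIs ->].
have pIs' : perm_eq Is (iota 0 (size t)) by rewrite -sz_st.
exists (map (nth y0 t) Is); first by apply/(perm_iotaP y0); exists Is.
rewrite all2E !size_map eqxx zip_map all_map /=; apply/allP => i.
by rewrite (perm_mem pIs) mem_iota => /= /st.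
Qed.
End All2.

Section PTree.
Variable O : choiceType.
Implicit Types (a b : O) (s r : seq (ptree O)) (t u v : ptree O).

Lemma ptree_ind' (P : ptree O -> Prop) :
  (forall a s, (forall t, t \in s -> P t) -> P (PNode a s)) -> forall t, P t.
Proof.
move=> IH; elim/ptree_nested_ind => a s IHs; apply: IH.
elim: s IHs => //= u s IHs [Pu /IHs{}IHs] t.
by rewrite inE => /predU1P[->|/IHs].
Qed.

Definition proot t : O := let: PNode a _ := t in a.
Definition psub t : seq (ptree O) := let: PNode _ s := t in s.

(* Isomorphism of decorated rooted trees, the order of siblings being
   forgotten. *)
Fixpoint piso t u : bool :=
  let: PNode a s := t in let: PNode b r := u in
  (a == b) && has (fun r' => all2 piso s r') (permutations r).

Lemma pisoP t u :
  reflect (proot t = proot u /\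
           exists2 r, perm_eq r (psub u) & all2 piso (psub t) r)
          (piso t u).
Proof.
case: t u => [a s] [b r] /=; apply: (iffP andP) => -[/eqP-> h]; split=> //.
  by case/hasP: h => r'; rewrite mem_permutations => p h; exists r'.
by case: h => r' p h; apply/hasP; exists r'; rewrite ?mem_permutations.
Qed.

Lemma piso_refl : reflexive piso.
Proof.
elim/ptree_ind' => a s IH; apply/pisoP; split=> //=; exists s => //.
elim: s IH => //= t s IHs IH; rewrite IH ?mem_head // IHs // => u us.
by apply: IH; rewrite inE us orbT.
Qed.

Lemma piso_impl_sym t u : piso t u -> piso u t.
Proof.
elim/ptree_ind': t u => a s IH [b r] /pisoP[/= -> [r' p h]].
have {}h : all2 piso r' s.
  elim: s r' IH h {p} => [|t s IHs] [|u r'] //= IH /andP[tu sr].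
  by rewrite IH ?mem_head //= IHs // => v vs; apply: IH; rewrite inE vs orbT.
rewrite perm_sym in p; have [s' ps h'] := all2_perm_l h p.
by apply/(pisoP (PNode b r) (PNode b s)); split=> //; exists s'.
Qed.

Lemma piso_sym : symmetric piso.
Proof. by move=> t u; apply/idP/idP; apply: piso_impl_sym. Qed.

Lemma piso_trans : transitive piso.
Proof.
move=> u t v; elim/ptree_ind': t u v => a s IH [b r] [c w].
move=> /pisoP[/= -> [r' pr sr]] /(pisoP (PNode b r) (PNode c w))[/= -> [w' pw rw]].
have [w'' pw' r'w] := all2_perm_l rw pr.
apply/(pisoP (PNode c s) (PNode c w)); split=> //; exists w''; first exact: perm_trans pw' pw.
elim: s r' w'' IH sr r'w {pr pw'} => [|x s IHs] [|y r'] [|z w''] //= IH.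
move=> /andP[xy sr] /andP[yz rz]; rewrite (IH x _ y) ?mem_head //=.
by apply: IHs rz => // q qs; apply: IH; rewrite inE qs orbT.
Qed.

Definition piso_equiv := EquivRel piso piso_refl piso_sym piso_trans.
Canonical piso_equiv.
End PTree.

Section Multisets.
Variable I : choiceType.
Implicit Types (m : {cmonom I}) (s : seq I) (i : I).

Definition cm_of_seq s : {cmonom I} := \big[mmul/mone]_(i <- s) ucm i.

(* The elements of m with multiplicity, in an irrelevant order. *)
Definition seq_of_cm m : seq I := flatten [seq nseq (m i) i | i <- finsupp m].

Lemma cm_of_seqE s i : cm_of_seq s i = count_mem i s.
Proof.
rewrite /cm_of_seq; elim: s => [|j s IHs]; first by rewrite big_nil onecmE.
by rewrite big_cons mulcmE IHs ucmE.
Qed.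

Lemma count_seq_of_cm m i : count_mem i (seq_of_cm m) = m i.
Proof.
rewrite /seq_of_cm count_flatten -map_comp sumnE big_map.
rewrite (eq_bigr (fun j => (j == i) * m j)) => [|j _]; last first.
  by rewrite /= count_nseq /= eq_sym.
have [im|inm] := boolP (i \in finsupp m); last first.
  rewrite (fsfun_dflt inm) big_seq big1 // => j jm.
  by case: eqP => // ji; rewrite -ji jm in inm.
rewrite (bigD1_seq i im (fset_uniq _)) /= ?eqxx ?mul1n // big1 ?addn0 //.
by move=> j /negPf->.
Qed.

Lemma seq_of_cmK : cancel seq_of_cm cm_of_seq.
Proof. by move=> m; apply/eqP/cmP => i; rewrite cm_of_seqE count_seq_of_cm. Qed.

Lemma perm_seq_of_cm s : perm_eq (seq_of_cm (cm_of_seq s)) s.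
Proof. by apply/allP => i _ /=; rewrite count_seq_of_cm cm_of_seqE. Qed.

Lemma eq_cm_of_seq s1 s2 : perm_eq s1 s2 -> cm_of_seq s1 = cm_of_seq s2.
Proof. by move=> p; apply/eqP/cmP => i; rewrite !cm_of_seqE (permP p). Qed.

Lemma cm_of_seq_cat s1 s2 :
  cm_of_seq (s1 ++ s2) = mmul (cm_of_seq s1) (cm_of_seq s2).
Proof. by rewrite /cm_of_seq big_cat. Qed.

Lemma seq_of_cmM m1 m2 :
  perm_eq (seq_of_cm (mmul m1 m2)) (seq_of_cm m1 ++ seq_of_cm m2).
Proof.
by rewrite -{1}(seq_of_cmK m1) -{1}(seq_of_cmK m2) -cm_of_seq_cat perm_seq_of_cm.
Qed.

Lemma seq_of_cm1 : seq_of_cm mone = [::].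
Proof. by rewrite /seq_of_cm mdom1. Qed.

Lemma seq_of_cmU i : seq_of_cm (ucm i) = [:: i].
Proof.
have: perm_eq (seq_of_cm (ucm i)) [:: i].
  by apply/allP => j _ /=; rewrite count_seq_of_cm ucmE addn0.
by move/perm_small_eq->.
Qed.

Lemma size_seq_of_cm m : size (seq_of_cm m) = mdeg m.
Proof.
rewrite /seq_of_cm size_flatten /shape -map_comp sumnE big_map.
by apply: eq_bigr => j _; rewrite /= size_nseq.
Qed.

Lemma mem_seq_of_cm m i : (i \in seq_of_cm m) = (i \in finsupp m).
Proof. by rewrite -has_pred1 has_count count_seq_of_cm lt0n cmE_neq0. Qed.
End Multisets.

Section MultisetMap.
Variables (I J : choiceType) (f : I -> J).

Definition cm_map (m : {cmonom I}) : {cmonom J} :=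
  cm_of_seq (map f (seq_of_cm m)).

Lemma cm_map_of_seq s : cm_map (cm_of_seq s) = cm_of_seq (map f s).
Proof. by apply/eq_cm_of_seq/perm_map/perm_seq_of_cm. Qed.

Lemma cm_map1 : cm_map mone = mone.
Proof. by rewrite /cm_map seq_of_cm1 /cm_of_seq big_nil. Qed.

Lemma cm_mapU i : cm_map (ucm i) = ucm (f i).
Proof. by rewrite /cm_map seq_of_cmU /cm_of_seq /= big_seq1. Qed.

Lemma cm_mapM m1 m2 : cm_map (mmul m1 m2) = mmul (cm_map m1) (cm_map m2).
Proof.
rewrite -cm_of_seq_cat -map_cat.
exact/eq_cm_of_seq/perm_map/seq_of_cmM.
Qed.
End MultisetMap.

Definition rtree (O : choiceType) := {eq_quot @piso_equiv O}%qT.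
HB.instance Definition _ (O : choiceType) := Choice.on (rtree O).
HB.instance Definition _ (O : choiceType) := EqQuotient.on (rtree O).

(* A forest is a finite multiset of rooted trees: [mmul] is concatenation,
   [mone] the empty forest, [ucm T] the forest reduced to T and [mdeg F] the
   number of trees of F. *)
Notation forest O := {cmonom (rtree O)}.

Section Trees.
Variable O : choiceType.
Implicit Types (a : O) (T : rtree O) (F : forest O).
Local Open Scope quotient_scope.

Definition troot T : O := proot (repr T).

(* The forest left when the root of T is deleted. *)
Definition tsub T : forest O :=
  cm_of_seq (map \pi_(rtree O) (psub (repr T))).

(* The grafting operator B_+^a on forests. *)
Definition bplus a F : rtree O :=
  \pi_(rtree O) (PNode a (map repr (seq_of_cm F))).

Definition single a : forest O := ucm (bplus a mone).

Lemma piso_repr_pi (t : ptree O) : piso (repr (\pi_(rtree O) t)) t.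
Proof. by apply/eqmodP; rewrite reprK. Qed.

Lemma all2_piso_pi (s r : seq (ptree O)) :
  all2 (@piso O) s r -> map \pi_(rtree O) s = map \pi_(rtree O) r.
Proof.
elim: s r => [|t s IHs] [|u r] //= /andP[tu /IHs->]; congr (_ :: _).
exact/eqmodP.
Qed.

Lemma troot_bplus a F : troot (bplus a F) = a.
Proof. by have /pisoP[] := piso_repr_pi (PNode a (map repr (seq_of_cm F))). Qed.

Lemma tsub_bplus a F : tsub (bplus a F) = F.
Proof.
rewrite -[RHS]seq_of_cmK; apply: eq_cm_of_seq.
have /pisoP[_ [/= r pr /all2_piso_pi->]] :=
  piso_repr_pi (PNode a (map repr (seq_of_cm F))).
by rewrite (perm_trans (perm_map _ pr)) // -map_comp (eq_map (@reprK _ _)) map_id.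
Qed.

Lemma bplusK T : bplus (troot T) (tsub T) = T.
Proof.
rewrite -[RHS]reprK; apply/eqmodP/pisoP; split=> //=.
have p : perm_eq (seq_of_cm (tsub T)) (map \pi_(rtree O) (psub (repr T))).
  exact: perm_seq_of_cm.
have h : all2 (@piso O) (map repr (map \pi_(rtree O) (psub (repr T))))
                        (psub (repr T)).
  by elim: (psub _) => //= t s ->; rewrite piso_repr_pi.
have [r pr h'] := all2_perm_l h (perm_map _ p).
by exists r.
Qed.

Lemma bplus_inj a a' F F' : bplus a F = bplus a' F' -> a = a' /\ F = F'.
Proof.
move=> e; split; first by rewrite -[LHS](troot_bplus a F) e troot_bplus.
by rewrite -[LHS](tsub_bplus a F) e tsub_bplus.
Qed.

(* A vertex is recorded by its decoration and its number of direct
   successors. *)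
Fixpoint pvertices (t : ptree O) : seq (O * nat) :=
  let: PNode a s := t in (a, size s) :: flatten (map pvertices s).

Definition tvertices T : seq (O * nat) := pvertices (repr T).

Definition fvertices F : seq (O * nat) := flatten (map tvertices (seq_of_cm F)).

Lemma pvertices_piso t u : piso t u -> perm_eq (pvertices t) (pvertices u).
Proof.
elim/ptree_ind': t u => a s IH [b r] /pisoP[/= -> [r' p h]].
have -> : size s = size r.
  by rewrite -(perm_size p); move: h; rewrite all2E => /andP[/eqP].
rewrite perm_cons -(permPr (perm_flatten (perm_map _ p))).
elim: s r' IH h {p} => [|t s IHs] [|u r'] //= IH /andP[tu sr].
apply: perm_cat; first by apply: IH => //; rewrite mem_head.
by apply: IHs => // v vs; apply: IH; rewrite inE vs orbT.
Qed.

Lemma tvertices_bplus a F :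
  perm_eq (tvertices (bplus a F)) ((a, mdeg F) :: fvertices F).
Proof.
rewrite (permPl (pvertices_piso (piso_repr_pi _))) /= size_map size_seq_of_cm.
by rewrite -map_comp.
Qed.

Lemma fverticesM F G :
  perm_eq (fvertices (mmul F G)) (fvertices F ++ fvertices G).
Proof.
by rewrite /fvertices -flatten_cat -map_cat perm_flatten ?perm_map ?seq_of_cmM.
Qed.

Lemma fvertices1 : fvertices mone = [::].
Proof. by rewrite /fvertices seq_of_cm1. Qed.

Lemma fverticesU T : fvertices (ucm T) = tvertices T.
Proof. by rewrite /fvertices seq_of_cmU /= cats0. Qed.

Definition fsize F : nat := size (fvertices F).

Lemma fsizeM F G : fsize (mmul F G) = fsize F + fsize G.
Proof. by rewrite /fsize (perm_size (fverticesM F G)) size_cat. Qed.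

Lemma fsize1 : fsize mone = 0.
Proof. by rewrite /fsize fvertices1. Qed.

Lemma fsize_bplus a F : fsize (ucm (bplus a F)) = (fsize F).+1.
Proof. by rewrite /fsize fverticesU (perm_size (tvertices_bplus a F)). Qed.

Lemma fsize_tsub T : fsize (ucm T) = (fsize (tsub T)).+1.
Proof. by rewrite -{1}(bplusK T) fsize_bplus. Qed.

Lemma divcmK F T : T \in seq_of_cm F -> mmul (ucm T) (divcm F (ucm T)) = F.
Proof.
rewrite mem_seq_of_cm -cmE_neq0 -lt0n => FT; apply/eqP/cmP => U.
by rewrite mulcmE divcmE ucmE subnKC //; case: eqP => // <-.
Qed.

Lemma fsize_mem F T : T \in seq_of_cm F -> fsize (ucm T) <= fsize F.
Proof. by move=> /divcmK h; rewrite -h fsizeM leq_addr. Qed.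

Lemma rtree_ind (P : rtree O -> Prop) :
  (forall a F, (forall T, T \in seq_of_cm F -> P T) -> P (bplus a F)) ->
  forall T, P T.
Proof.
move=> IH T; have [n] := ubnP (fsize (ucm T)); elim: n T => // n IHn T.
rewrite fsize_tsub -{2}(bplusK T) => lt_n; apply: IH => U /fsize_mem leU.
exact/IHn/(leq_ltn_trans leU).
Qed.
End Trees.

Section Fold.
Variables (O B : choiceType) (phi : O -> {cmonom B} -> B).

Fixpoint pfold (t : ptree O) : B :=
  let: PNode a s := t in phi a (cm_of_seq (map pfold s)).

Definition tfold (T : rtree O) : B := pfold (repr T).

Lemma pfold_piso t u : piso t u -> pfold t = pfold u.
Proof.
elim/ptree_ind': t u => a s IH [b r] /pisoP[/= -> [r' p h]]; congr (phi _ _).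
rewrite -(eq_cm_of_seq (perm_map _ p)); congr cm_of_seq.
elim: s r' IH h {p} => [|t s IHs] [|u r'] //= IH /andP[tu sr].
rewrite (IH _ _ _ tu) ?mem_head // (IHs r') // => v vs.
by apply: IH; rewrite inE vs orbT.
Qed.

Lemma tfold_bplus a F : tfold (bplus a F) = phi a (cm_map tfold F).
Proof. by rewrite /tfold (pfold_piso (piso_repr_pi _)) /= -map_comp. Qed.
End Fold.

(* {malg R[forest O]} is the monoid algebra of the free commutative monoid on
   rooted trees, that is, the free commutative algebra on rooted trees. *)
Notation forest_alg R O := {malg R[forest O]}.

Lemma malgUZ (R : realType) (K : choiceType) (c : R) (k : K) :
  (<< c *g k >> = c *: << k >> :> {malg R[K]})%R.
Proof.
by apply/malgP => l; rewrite (mcoeffZ c << k >>%R) !mcoeffU mulrnAr mulr1.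
Qed.

Lemma malg_lin_ind (R : realType) (K : choiceType) (P : {malg R[K]} -> Prop) :
  (P 0 -> (forall c k u, P u -> P (c *: << k >> + u)) -> forall u, P u)%R.
Proof.
move=> P0 PD u; rewrite [u]monalgE; elim: (enum_fset _) => [|k s IHs].
  by rewrite big_nil.
by rewrite big_cons malgUZ; exact: PD.
Qed.

Lemma malgUM (R : realType) (M : monomType) (k l : M) :
  (<< k >> * << l >> = << mmul k l >> :> {malg R[M]})%R.
Proof. by rewrite malgM_def fgmulUU mulr1. Qed.

Section LinearExtension.
Variables (R : realType) (K : choiceType) (V : lmodType R) (h : K -> V).
Local Open Scope ring_scope.

Definition linext (u : {malg R[K]}) : V := \sum_(k <- msupp u) u@_k *: h k.

Lemma linextEw (d : {fset K}) u : (msupp u `<=` d)%fset ->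
  linext u = \sum_(k <- d) u@_k *: h k.
Proof.
move=> le; rewrite /linext (big_fset_incl _ le) // => k _ /mcoeff_outdom->.
by rewrite scale0r.
Qed.

Lemma linext_is_linear : linear linext.
Proof.
move=> c u v; pose d := (msupp u `|` msupp v `|` msupp (c *: u + v))%fset.
have le1 : (msupp u `<=` d)%fset by rewrite /d -fsetUA fsubsetUl.
have le2 : (msupp v `<=` d)%fset.
  by rewrite /d [(_ `|` msupp v)%fset]fsetUC -fsetUA fsubsetUl.
rewrite (linextEw le1) (linextEw le2) (@linextEw d) ?fsubsetUr //.
rewrite scaler_sumr -big_split /=; apply: eq_bigr => k _.
by rewrite mcoeffD mcoeffZ scalerDl scalerA.
Qed.

HB.instance Definition _ :=
  GRing.isLinear.Build R {malg R[K]} V _ linext linext_is_linear.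

Lemma linextU k : linext << k >> = h k.
Proof.
by rewrite (linextEw (msuppU_le (x := 1))) big_seq_fset1 mcoeffUU scale1r.
Qed.
End LinearExtension.

Section Span.
Variables (R : realType) (O : choiceType).
Local Open Scope ring_scope.

Definition lspan (P : pred (forest O)) (u : forest_alg R O) : Prop :=
  exists n (c : 'I_n -> R) (f : 'I_n -> forest O),
    (forall i, P (f i)) /\ u = \sum_i c i *: << f i >>.

Lemma lspanP P u : lspan P u <-> forall F, F \in msupp u -> P F.
Proof.
split=> [[n [c [f [Pf ->]]]] F|Pu].
  rewrite -mcoeff_neq0; apply: contraNT => nPF; rewrite raddf_sum /= big1 //.
  move=> i _; rewrite mcoeffZ mcoeffU1; case: eqP => [fi|_]; last by rewrite mulr0.
  by rewrite -fi Pf in nPF.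
pose s := enum_fset (msupp u).
exists (size s), (fun i => u@_(tnth (in_tuple s) i)), (tnth (in_tuple s)).
split=> [i|]; first by apply: Pu; exact: mem_tnth.
rewrite -(big_tnth _ _ s xpredT (fun F => u@_F *: << F >>)) {1}[u]monalgE.
by apply: eq_bigr => F _; rewrite malgUZ.
Qed.
End Span.

Section Shuffle.
Variables (R : realType) (O : choiceType).
Local Notation A := (forest_alg R O).
Local Open Scope ring_scope.

Definition Bplus (a : O) : A -> A := linext (fun F => << ucm (bplus a F) >>).

HB.instance Definition _ a := GRing.Linear.on (Bplus a).

Lemma BplusU a F : Bplus a << F >> = << ucm (bplus a F) >>.
Proof. exact: linextU. Qed.

Lemma BplusD a u v : Bplus a (u + v) = Bplus a u + Bplus a v.
Proof. exact: linearD. Qed.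

Lemma BplusZ a c u : Bplus a (c *: u) = c *: Bplus a u.
Proof. exact: linearZ. Qed.

Lemma Bplus0 a : Bplus a 0 = 0.
Proof. exact: linear0. Qed.

Variables (lam : R) (op : O -> O -> O).

(* The recursion on the total number of vertices is bounded by the fuel n.
   [divcm F (ucm T)] is F with one copy of T removed. The product of two trees
   is the instance mdeg F = mdeg F' = 1 of the sum; the defining equations of
   the product are [shuffle1F], [shuffleF1], [shuffle_forest], [shuffle_tree]. *)
Fixpoint shuffle_rec (n : nat) (F F' : forest O) : A :=
  if n is n'.+1 then
    if F == mone then << F' >> else
    if F' == mone then << F >> else
    ((mdeg F * mdeg F')%:R)^-1 *:
      \sum_(T <- seq_of_cm F) \sum_(T' <- seq_of_cm F')
        (Bplus (troot T) (shuffle_rec n' (tsub T) (ucm T'))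
         + Bplus (troot T') (shuffle_rec n' (ucm T) (tsub T'))
         + lam *: Bplus (op (troot T) (troot T'))
                        (shuffle_rec n' (tsub T) (tsub T')))
        * << mmul (divcm F (ucm T)) (divcm F' (ucm T')) >>
  else 0.

Definition shuffle_forests (F F' : forest O) : A :=
  shuffle_rec (fsize F + fsize F').+1 F F'.

Definition shuffle (u v : A) : A :=
  linext (fun F => linext (fun F' => shuffle_forests F F') v) u.

Lemma shuffle_linearl v : linear (shuffle^~ v).
Proof. by move=> c u u'; rewrite /shuffle linearP. Qed.

Lemma shuffle_linearr u : linear (shuffle u).
Proof.
move=> c v v'; rewrite /shuffle /linext scaler_sumr -big_split /=.
apply: eq_bigr => F _; rewrite -/(linext _ _) linearP scalerDr !scalerA.
by rewrite mulrC.
Qed.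

HB.instance Definition _ u :=
  GRing.isLinear.Build R A A _ (shuffle u) (shuffle_linearr u).

Lemma shuffle_recS n F F' :
  shuffle_rec n.+1 F F' =
    if F == mone then << F' >> else
    if F' == mone then << F >> else
    ((mdeg F * mdeg F')%:R)^-1 *:
      \sum_(T <- seq_of_cm F) \sum_(T' <- seq_of_cm F')
        (Bplus (troot T) (shuffle_rec n (tsub T) (ucm T'))
         + Bplus (troot T') (shuffle_rec n (ucm T) (tsub T'))
         + lam *: Bplus (op (troot T) (troot T'))
                        (shuffle_rec n (tsub T) (tsub T')))
        * << mmul (divcm F (ucm T)) (divcm F' (ucm T')) >>.
Proof. by []. Qed.

Lemma shuffle_rec_fuel m n F F' :
  (fsize F + fsize F' < m)%N -> (fsize F + fsize F' < n)%N ->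
  shuffle_rec m F F' = shuffle_rec n F F'.
Proof.
elim: m n F F' => [|m IHm] [|n] F F' lt_m lt_n; [by []|by []|by []|].
rewrite !shuffle_recS; case: eqP => [_|_]; first by [].
case: eqP => [_|_]; first by [].
apply: (congr1 (GRing.scale _)).
apply: eq_big_seq => T /fsize_mem leT; apply: eq_big_seq => T' /fsize_mem leT'.
apply: (congr1 (fun u => u * _)).
have le : (fsize (ucm T) + fsize (ucm T') <= fsize F + fsize F')%N.
  exact: leq_add.
have {}lt_m := leq_ltn_trans le lt_m; have {lt_n le}lt_n := leq_ltn_trans le lt_n.
move: lt_m lt_n; rewrite !fsize_tsub !addSn !addnS !ltnS => lt_m lt_n.
by rewrite !(IHm n) ?fsize_tsub ?addnS ?addSn ?ltnS // (leq_trans _ lt_m, leq_trans _ lt_n).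
Qed.

Lemma shuffle_basis F F' :
  shuffle << F >> << F' >> = shuffle_rec (fsize F + fsize F').+1 F F'.
Proof. by rewrite /shuffle !linextU. Qed.

Lemma shuffle_recE n F F' : (fsize F + fsize F' < n)%N ->
  shuffle_rec n F F' = shuffle << F >> << F' >>.
Proof. by move=> lt_n; rewrite shuffle_basis; exact: shuffle_rec_fuel. Qed.

Lemma shuffle1F F : shuffle << mone >> << F >> = << F >>.
Proof. by rewrite shuffle_basis shuffle_recS eqxx. Qed.

Lemma shuffleF1 F : shuffle << F >> << mone >> = << F >>.
Proof. rewrite shuffle_basis shuffle_recS eqxx.
by case: eqP => [->|_]; reflexivity. Qed.

Lemma divcmU (T : rtree O) : divcm (ucm T) (ucm T) = mone.
Proof. by apply/eqP/cmP => U; rewrite divcmE subnn onecmE. Qed.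

Lemma shuffle_tree a a' f f' :
  let T := bplus a f in let T' := bplus a' f' in
  shuffle << ucm T >> << ucm T' >> =
    Bplus a (shuffle << f >> << ucm T' >>)
    + Bplus a' (shuffle << ucm T >> << f' >>)
    + lam *: Bplus (op a a') (shuffle << f >> << f' >>).
Proof.
move=> T T'.
rewrite [LHS]shuffle_basis.
rewrite [LHS]shuffle_recS.
rewrite !cm1_eq1 !mdegU muln1.
rewrite invr1 scale1r !seq_of_cmU !big_seq1 !divcmU mulm1.
rewrite [X in _ * X](_ : _ = 1); last reflexivity.
rewrite mulr1 !troot_bplus !tsub_bplus.
rewrite !shuffle_recE.
  reflexivity.
all: by rewrite /T /T' !fsize_bplus ?addSn ?addnS // ltnS ltnW.
Qed.

Lemma shuffle_treeE T T' :
  shuffle << ucm T >> << ucm T' >> =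
    Bplus (troot T) (shuffle << tsub T >> << ucm T' >>)
    + Bplus (troot T') (shuffle << ucm T >> << tsub T' >>)
    + lam *: Bplus (op (troot T) (troot T'))
                   (shuffle << tsub T >> << tsub T' >>).
Proof.
by have := shuffle_tree (troot T) (troot T') (tsub T) (tsub T'); rewrite !bplusK.
Qed.

Lemma shuffle_forest F F' : F != mone -> F' != mone ->
  shuffle << F >> << F' >> =
    ((mdeg F * mdeg F')%:R)^-1 *:
      \sum_(T <- seq_of_cm F) \sum_(T' <- seq_of_cm F')
        shuffle << ucm T >> << ucm T' >>
        * << mmul (divcm F (ucm T)) (divcm F' (ucm T')) >>.
Proof.
move=> /negPf F1 /negPf F'1.
rewrite [LHS]shuffle_basis [LHS]shuffle_recS F1 F'1.
apply: (congr1 (GRing.scale _)); apply: eq_big_seq => T /fsize_mem leT.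
apply: eq_big_seq => T' /fsize_mem leT'; apply: (congr1 (fun u => u * _)).
rewrite [RHS]shuffle_treeE.
have := leq_add leT leT'; rewrite !fsize_tsub addSn addnS => le.
rewrite !shuffle_recE; first reflexivity.
all: rewrite ?fsize_tsub ?addSn ?addnS //; exact: ltnW.
Qed.

End Shuffle.

Section ZeroLambda.
Variables (R : realType) (O : choiceType).
Local Open Scope ring_scope.

Lemma shuffle0_op (op op' : O -> O -> O) (u v : forest_alg R O) :
  shuffle 0 op u v = shuffle 0 op' u v.
Proof.
suff E n F F' : shuffle_rec (0 : R) op n F F' = shuffle_rec 0 op' n F F'.
  rewrite /shuffle /linext; apply: eq_bigr => F _.
  apply: (congr1 (GRing.scale _)); apply: eq_bigr => F' _.
  by apply: (congr1 (GRing.scale _)); exact: E.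
elim: n F F' => [|n IHn] F F'; first by [].
rewrite !shuffle_recS; case: eqP => [_|_]; first by [].
case: eqP => [_|_]; first by [].
apply: (congr1 (GRing.scale _)); apply: eq_bigr => T _; apply: eq_bigr => T' _.
apply: (congr1 (fun u => u * _)); rewrite [in LHS]scale0r [in RHS]scale0r.
apply: (congr1 (fun u => u + 0)).
by apply: (f_equal2 +%R); apply: (congr1 (Bplus _)); exact: IHn.
Qed.

(* The law given to [shuffle] is arbitrary, by [shuffle0_op]. *)
Definition shuffle0 : forest_alg R O -> forest_alg R O -> forest_alg R O :=
  shuffle 0 (fun a _ => a).
End ZeroLambda.

#[local] Opaque fgadd fgmul fgscale fgopp fgone mkmalgU mcoeff linext Bplus shuffle.

Definition Nstar := {n : nat | 0 < n}.
HB.instance Definition _ := Choice.on Nstar.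
HB.instance Definition _ := SubType.on Nstar.

Definition Nstar1 : Nstar := exist _ 1 isT.

Definition Nstar_add (m n : Nstar) : Nstar :=
  exist _ (val m + val n) (ltn_addr (val n) (valP m)).

Lemma Nstar_addA : associative Nstar_add.
Proof. by move=> m n p; apply: val_inj; rewrite /= addnA. Qed.

Lemma Nstar_addC : commutative Nstar_add.
Proof. by move=> m n; apply: val_inj; rewrite /= addnC. Qed.

Definition stuffle (R : realType) :
    forest_alg R Nstar -> forest_alg R Nstar -> forest_alg R Nstar :=
  shuffle 1%R Nstar_add.

Inductive letter := lx | ly.

Definition letter_is_y (l : letter) : bool := if l is ly then true else false.
Definition letter_of_bool (b : bool) : letter := if b then ly else lx.

Lemma letter_is_yK : cancel letter_is_y letter_of_bool.
Proof. by case. Qed.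

HB.instance Definition _ := Choice.copy letter (can_type letter_is_yK).

Definition convergentN (F : forest Nstar) : bool :=
  all (fun T => 2 <= val (troot T)) (seq_of_cm F).

Definition leaf_or_branching (v : letter * nat) : bool :=
  (v.2 == 0) || (1 < v.2).

Definition semiconvergent (F : forest letter) : bool :=
  all (fun v => leaf_or_branching v ==> (v.1 == ly)) (fvertices F).

Definition convergentxy (F : forest letter) : bool :=
  semiconvergent F && all (fun T => troot T == lx) (seq_of_cm F).

Definition tbin : rtree Nstar -> rtree letter :=
  tfold (fun n F => iter (val n).-1 (fun T => bplus lx (ucm T)) (bplus ly F)).

Lemma tbin_bplus n F :
  tbin (bplus n F) =
    iter (val n).-1 (fun T => bplus lx (ucm T)) (bplus ly (cm_map tbin F)).
Proof. exact: tfold_bplus. Qed.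

Section Binarisation.
Variable R : realType.
Local Notation AN := (forest_alg R Nstar).
Local Notation Axy := (forest_alg R letter).
Local Open Scope ring_scope.

Definition bin : AN -> Axy := linext (fun F => << cm_map tbin F >>).

HB.instance Definition _ := GRing.Linear.on bin.

Lemma binU F : bin << F >> = << cm_map tbin F >>.
Proof. exact: linextU. Qed.

#[local] Opaque bin.

Lemma binD u v : bin (u + v) = bin u + bin v.
Proof. exact: linearD. Qed.

Lemma binZ c u : bin (c *: u) = c *: bin u.
Proof. exact: linearZ. Qed.

Lemma bin0 : bin 0 = 0.
Proof. exact: linear0. Qed.

Lemma bin_is_monoid_morphism : monoid_morphism bin.
Proof.
split=> [|u v]; first by rewrite binU cm_map1.
elim/malg_lin_ind: u => [|c F u IHu]; first by rewrite mul0r bin0 mul0r.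
rewrite [in LHS]mulrDl.
rewrite [in LHS]binD.
rewrite [in RHS]binD.
rewrite [in RHS]mulrDl.
apply: (f_equal2 +%R); last exact: IHu.
rewrite -[in LHS]scalerAl [in LHS]binZ [in RHS]binZ -[in RHS]scalerAl; apply: (congr1 (GRing.scale _)) => {c u IHu}.
elim/malg_lin_ind: v => [|c G v IHv]; first by rewrite mulr0 bin0 mulr0.
rewrite [in LHS]mulrDr.
rewrite [in LHS]binD.
rewrite [in RHS]binD.
rewrite [in RHS]mulrDr.
apply: (f_equal2 +%R); last exact: IHv.
rewrite -[in LHS]scalerAr [in LHS]binZ [in RHS]binZ -[in RHS]scalerAr; apply: (congr1 (GRing.scale _)).
rewrite [in LHS]malgUM [in LHS]binU cm_mapM -[in LHS]malgUM.
by apply: (f_equal2 *%R); rewrite binU.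
Qed.

HB.instance Definition _ :=
  GRing.isMonoidMorphism.Build AN Axy bin bin_is_monoid_morphism.

Lemma bin_Bplus n u :
  bin (Bplus n u) = iter (val n).-1 (Bplus lx) (Bplus ly (bin u)).
Proof.
elim/malg_lin_ind: u => [|c F u IHu].
  rewrite !Bplus0 !bin0 Bplus0.
  by elim: (val n).-1 => //= k <-; rewrite Bplus0.
have itP k d v w : iter k (Bplus lx) (d *: v + w) =
    d *: iter k (Bplus lx) v + iter k (Bplus lx) w :> Axy.
  elim: k => [|k IHk]; first by [].
  by rewrite !iterS IHk BplusD BplusZ.
have itU k T : iter k (Bplus lx) << ucm T >> =
    << ucm (iter k (fun T => bplus lx (ucm T)) T) >> :> Axy.
  elim: k => [|k IHk]; first by [].
  rewrite [in LHS]iterS IHk BplusU; exact: erefl.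
rewrite [in LHS]BplusD [in LHS]BplusZ [in LHS]binD [in LHS]binZ.
rewrite [in RHS]binD [in RHS]binZ [in RHS]BplusD [in RHS]BplusZ [RHS]itP.
apply: (f_equal2 +%R); last exact: IHu.
apply: (congr1 (GRing.scale _)) => {IHu c u}.
rewrite [in LHS]BplusU [in LHS]binU [in RHS]binU [in RHS]BplusU itU.
by rewrite cm_mapU tbin_bplus.
Qed.

Definition tunbin : rtree letter -> rtree Nstar :=
  tfold (fun l F =>
    if l is ly then bplus Nstar1 F
    else if seq_of_cm F is T :: _ then
      bplus (Nstar_add Nstar1 (troot T)) (tsub T)
    else bplus Nstar1 F).

Lemma tbinK : cancel tbin tunbin.
Proof.
elim/rtree_ind => n F IH; rewrite tbin_bplus.
have -> : n = iter (val n).-1 (Nstar_add Nstar1) Nstar1.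
  apply: val_inj; case: n => -[//|n] /= _.
  by elim: n => //= n IHn; rewrite -IHn.
rewrite [in LHS](_ : val _ = (val n).-1.+1); last first.
  by elim: (val n).-1 => //= k ->.
rewrite [_.+1.-1]/=; elim: (val n).-1 => [|k IHk] /=.
  rewrite /tunbin tfold_bplus -/tunbin; congr bplus.
  rewrite -[RHS]seq_of_cmK [cm_map tbin F]/cm_map cm_map_of_seq -map_comp.
  by congr cm_of_seq; rewrite -[RHS]map_id; apply/eq_in_map.
by rewrite /tunbin tfold_bplus -/tunbin cm_mapU IHk seq_of_cmU troot_bplus tsub_bplus.
Qed.

Lemma bin_inj : injective bin.
Proof.
pose g : Axy -> AN := linext (fun F => << cm_map tunbin F >>).
suff: cancel bin g by exact: can_inj.
elim/malg_lin_ind => [|c F u IHu]; first by rewrite bin0 /g linear0.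
rewrite binD binZ /g; apply: (etrans (linearP _ _ _ _)).
apply: (f_equal2 +%R); last exact: IHu.
rewrite /= binU linextU; apply: (congr1 (GRing.scale _)).
apply: (congr1 (fun F : forest Nstar => << F >>)).
rewrite -[RHS]seq_of_cmK [cm_map tbin F]/cm_map cm_map_of_seq -map_comp.
by apply: (congr1 (@cm_of_seq _)); rewrite -[RHS]map_id; apply/eq_map/tbinK.
Qed.

Let sct (T : rtree letter) : bool := semiconvergent (ucm T).

Lemma semiconvergentE F : semiconvergent F = all sct (seq_of_cm F).
Proof.
rewrite /semiconvergent /fvertices; elim: (seq_of_cm F) => //= T s IHs.
by rewrite all_cat IHs /sct /semiconvergent fverticesU.
Qed.

Lemma semiconvergent_bplus l F :
  semiconvergent (ucm (bplus l F)) =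
    ((mdeg F != 1%N) ==> (l == ly)) && semiconvergent F.
Proof.
rewrite {1}/semiconvergent fverticesU (perm_all _ (tvertices_bplus l F)) /=.
by congr (_ && _); rewrite /leaf_or_branching /=; case: (mdeg F) => [|[]].
Qed.

Lemma semiconvergent_bin F : semiconvergent (cm_map tbin F).
Proof.
have sc G : (forall T, T \in seq_of_cm G -> sct (tbin T)) ->
    semiconvergent (cm_map tbin G).
  move=> h; rewrite semiconvergentE (perm_all _ (perm_seq_of_cm _)) all_map.
  exact/allP.
suff st T : sct (tbin T) by exact: sc.
elim/rtree_ind: T => n G /sc scG.
rewrite /sct tbin_bplus; elim: (val n).-1 => [|k IHk] /=.
  by rewrite semiconvergent_bplus eqxx implybT.
by rewrite semiconvergent_bplus mdegU.
Qed.

Lemma tunbinK T : sct T -> tbin (tunbin T) = T.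
Proof.
elim/rtree_ind: T => l F IH; rewrite /sct semiconvergent_bplus => /andP[lF].
rewrite semiconvergentE => /allP scF; rewrite /tunbin tfold_bplus -/tunbin.
case: l lF => /= [|_]; last first.
  rewrite tbin_bplus /=; congr bplus.
  rewrite -[RHS]seq_of_cmK [cm_map tunbin F]/cm_map cm_map_of_seq -map_comp.
  congr cm_of_seq; rewrite -[RHS]map_id; apply/eq_in_map => T TF /=.
  by apply: IH => //; exact: scF.
rewrite implybF negbK -size_seq_of_cm => F1.
have [U EF] : exists U, F = ucm U.
  rewrite -[F]seq_of_cmK; case: (seq_of_cm F) F1 => [|U []] // _.
  by exists U; rewrite /cm_of_seq big_seq1.
have IHU : tbin (tunbin U) = U.
  by apply: IH; [|apply: scF]; rewrite EF seq_of_cmU mem_head.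
rewrite EF cm_mapU seq_of_cmU /= -[in RHS]IHU -{3}(bplusK (tunbin U)) !tbin_bplus.
by case: (troot (tunbin U)) => -[].
Qed.

Lemma range_bin (u : Axy) : range bin u <-> lspan semiconvergent u.
Proof.
split.
  case=> v _ <-; apply/lspanP; elim/malg_lin_ind: v => [|c F v IHv] G.
    by rewrite bin0 msupp0.
  rewrite binD binZ binU => /(fsubsetP (msuppD_le _ _)); rewrite in_fsetU.
  case/orP => [/(fsubsetP (msuppZ_le _ _))|/IHv //].
  by rewrite msuppU1 in_fset1 => /eqP->; exact: semiconvergent_bin.
case=> n [c [f [scf ->]]].
exists (\sum_(i < n) c i *: << cm_map tunbin (f i) >>) => //.
apply: (etrans (linear_sum _ _ _ _)); apply: eq_bigr => i _.
apply: (etrans (binZ _ _)); apply: (congr1 (GRing.scale _)).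
apply: (etrans (binU _)); apply: (congr1 (fun F : forest letter => << F >>)).
rewrite -[RHS]seq_of_cmK [cm_map tunbin _]/cm_map cm_map_of_seq -map_comp.
apply: (congr1 (@cm_of_seq _)); rewrite -[RHS]map_id; apply/eq_in_map => T Tf /=.
apply: tunbinK; have := scf i; rewrite semiconvergentE => /allP; exact.
Qed.

(* The inverse of the injective map [bin] on its image, which is the span of
   the semiconvergent forests ([range_bin]); 0 elsewhere. *)
Definition bin_inv : Axy -> AN := 'pinv_(fun=> 0) setT bin.

Lemma bin_invK u : range bin u -> bin (bin_inv u) = u.
Proof. by move=> ru; rewrite /bin_inv pinvK // inE. Qed.

Lemma binK v : bin_inv (bin v) = v.
Proof. by apply: bin_inj; rewrite bin_invK //; exists v. Qed.
End Binarisation.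

(* Main.v *)
Require Import Defs.
From mathcomp Require Import all_boot all_order all_algebra.
From mathcomp Require Import finmap.
From mathcomp Require Import boolp classical_sets functions reals.
From mathcomp Require Import monalg.

Set Implicit Arguments.
Unset Strict Implicit.
Unset Printing Implicit Defensive.

Import GRing.Theory.

(** Over a tree, the product with a single vertex unfolds into
      single a * B_b(f) = B_a(B_b(f)) + B_b(single a * f) + lam B_(a+b)(f),
    the last term being absent from the shuffle. Let T = B_n(f) with n >= 2.
    Binarisation turns the first term of the stuffle, whose root is 1, into
    B_y(bin T), which is also the first term of the shuffle of y with bin T:
    the two divergent terms cancel in the difference. The roots of the other
    two terms of the stuffle are n and n + 1, so their binarisations have
    root x. Since n >= 2, bin T = B_x(T'), and what remains of the shuffle is
    B_x(y * T'), whose roots are x as well ([single_tree_convergentxy]).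

    This last term must moreover be semiconvergent: a root x may have only one
    child. So one needs that shuffling y with a semiconvergent forest gives
    semiconvergent forests, and that shuffling it with a single tree gives
    single trees ([shuffle0_single_semiconvergent_tree]).

    Over a forest the product with a single vertex is the average of the
    products with each tree in turn. Binarisation respects this average, and
    the untouched trees are convergent, so the result for trees passes to
    forests ([single_convergentxy]). The statement on forests decorated by
    positive integers is equivalent to the one on forests decorated by x and
    y, because binarisation is injective and both preserves and reflects
    convergence ([lspan_convergent_bin]). *)

(* Conversion must not unfold the finitely supported functions that implement
   the algebra: unification of two distinct products would not terminate in
   reasonable time. *)
#[local] Opaque fgadd fgmul fgscale fgopp fgone mkmalgU mcoeff linext Bplus.
#[local] Opaque shuffle bin.

(** * Spans of forests *)

Section SpanTheory.
Variables (R : realType) (O : choiceType).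
Implicit Types (P Q S : pred (forest O)) (u v : forest_alg R O).
Implicit Types (F G : forest O).
Local Open Scope ring_scope.

Lemma lspanU P F : P F -> lspan P (<< F >> : forest_alg R O).
Proof. by move=> PF; apply/lspanP => G; rewrite msuppU1 in_fset1 => /eqP->. Qed.

Lemma lspan0 P : lspan P (0 : forest_alg R O).
Proof. by apply/lspanP => G; rewrite msupp0. Qed.

Lemma lspanD P u v : lspan P u -> lspan P v -> lspan P (u + v).
Proof.
move=> /lspanP Pu /lspanP Pv; apply/lspanP => F.
move=> /(fsubsetP (msuppD_le _ _)); rewrite in_fsetU.
by case/orP => [/Pu|/Pv].
Qed.

Lemma lspanZ P c u : lspan P u -> lspan P (c *: u).
Proof.
by move=> /lspanP Pu; apply/lspanP => F /(fsubsetP (msuppZ_le _ _))/Pu.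
Qed.

Lemma lspanB P u v : lspan P u -> lspan P v -> lspan P (u - v).
Proof. by move=> Pu Pv; rewrite -scaleN1r; exact: lspanD Pu (lspanZ _ Pv). Qed.

Lemma lspan_sum P (I : eqType) (s : seq I) (h : I -> forest_alg R O) :
  (forall i, i \in s -> lspan P (h i)) -> lspan P (\sum_(i <- s) h i).
Proof.
move=> Ph; rewrite big_seq; apply: (big_ind (lspan P)) => //.
- exact: lspan0.
- exact: lspanD.
Qed.

Lemma lspanMU P Q S u G :
  (forall F, P F -> Q G -> S (mmul F G)) ->
  lspan P u -> Q G -> lspan S (u * << G >>).
Proof.
move=> PQS [n [c [f [Pf ->]]]] QG; rewrite mulr_suml; apply: lspan_sum => i _.
rewrite -scalerAl malgUM; apply/lspanZ/lspanU; exact: PQS.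
Qed.

End SpanTheory.

Lemma lspan_linear (R : realType) (O O' : choiceType) (P : pred (forest O))
    (Q : pred (forest O')) (h : {linear forest_alg R O -> forest_alg R O'})
    (u : forest_alg R O) :
  (forall F, P F -> lspan Q (h << F >>%R)) -> lspan P u -> lspan Q (h u).
Proof.
move=> PQ [n [c [f [Pf ->]]]]; rewrite linear_sum; apply: lspan_sum => i _.
by rewrite linearZ; apply/lspanZ/PQ.
Qed.

(** * Product with a single vertex *)

Section SingleShuffle.
Variables (R : realType) (O : choiceType) (lam : R) (op : O -> O -> O) (a : O).
Local Open Scope ring_scope.
Local Notation "a ⧢ F" :=
  (shuffle lam op << single a >> << F >>) (at level 40).

Lemma shuffle_single_tree b f :
  a ⧢ ucm (bplus b f) =
    << ucm (bplus a (ucm (bplus b f))) >> + Bplus b (a ⧢ f)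
    + lam *: << ucm (bplus (op a b) f) >>.
Proof.
apply: (etrans (shuffle_tree lam op a b mone f)).
apply: (f_equal2 +%R); first apply: (congr1 (fun u => u + _)).
  by apply: (etrans (congr1 (Bplus a) (shuffle1F lam op _))); exact: BplusU.
apply: (congr1 (GRing.scale lam)).
by apply: (etrans (congr1 (Bplus _) (shuffle1F lam op f))); exact: BplusU.
Qed.

(** A forest reduced to one vertex has a single tree, so the double average
    defining the product is an average over the trees of F alone. *)
Lemma shuffle_single_forest F : F != mone ->
  a ⧢ F = (mdeg F)%:R^-1 *:
    \sum_(T <- seq_of_cm F) (a ⧢ ucm T) * << divcm F (ucm T) >>.
Proof.
move=> F1; have a1 : single a != mone by rewrite cm1_eq1.
apply: (etrans (shuffle_forest lam op a1 F1)).
rewrite mdegU mul1n; apply: (congr1 (GRing.scale _)).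
rewrite [in seq_of_cm (single a)]/single seq_of_cmU big_seq1.
apply: eq_bigr => T _; apply: (congr1 (fun m => _ * << m >>)).
by rewrite divcmU mul1m.
Qed.

End SingleShuffle.

(** * Convergence and binarisation *)

Section Convergence.

Lemma all_seq_of_cmM (O : choiceType) (p : pred (rtree O)) (F G : forest O) :
  all p (seq_of_cm (mmul F G)) = all p (seq_of_cm F) && all p (seq_of_cm G).
Proof. by rewrite (perm_all _ (seq_of_cmM F G)) all_cat. Qed.

Lemma semiconvergentM F G :
  semiconvergent (mmul F G) = semiconvergent F && semiconvergent G.
Proof. by rewrite /semiconvergent (perm_all _ (fverticesM F G)) all_cat. Qed.

Lemma convergentxyM F G :
  convergentxy (mmul F G) = convergentxy F && convergentxy G.
Proof.
by rewrite /convergentxy semiconvergentM all_seq_of_cmM andbACA.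
Qed.

Lemma convergentNM F G :
  convergentN (mmul F G) = convergentN F && convergentN G.
Proof. exact: all_seq_of_cmM. Qed.

(** The root of tbin (B_n(f)) is the first of n - 1 letters x followed by a y,
    so it is x exactly when n >= 2. *)
Lemma troot_tbin T : (troot (tbin T) == lx) = (2 <= val (troot T)).
Proof.
rewrite -{1}(bplusK T) tbin_bplus.
by case: (troot T) => -[|[|n]] //= _; rewrite troot_bplus.
Qed.

Lemma convergentxy_bin F : convergentxy (cm_map tbin F) = convergentN F.
Proof.
rewrite /convergentxy semiconvergent_bin (perm_all _ (perm_seq_of_cm _)).
rewrite all_map /=.
by apply: eq_all => T /=; exact: troot_tbin.
Qed.

Lemma cm_map_tunbinK F : semiconvergent F -> cm_map tbin (cm_map tunbin F) = F.
Proof.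
rewrite semiconvergentE => /allP scF.
rewrite -[RHS]seq_of_cmK [cm_map tunbin F]/cm_map cm_map_of_seq -map_comp.
apply: (congr1 (@cm_of_seq _)); rewrite -[RHS]map_id.
by apply/eq_in_map => T /scF; exact: tunbinK.
Qed.

Lemma divcm_tbin F T : T \in seq_of_cm F ->
  divcm (cm_map tbin F) (ucm (tbin T)) = cm_map tbin (divcm F (ucm T)).
Proof.
move=> /divcmK {1}<-; rewrite cm_mapM cm_mapU.
by apply/eqP/cmP => U; rewrite divcmE mulcmE addKn.
Qed.

Lemma mdeg_cm_map_tbin F : mdeg (cm_map tbin F) = mdeg F.
Proof.
by rewrite -!size_seq_of_cm (perm_size (perm_seq_of_cm _)) size_map.
Qed.

End Convergence.

Section Proof.
Variable R : realType.
Local Open Scope ring_scope.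

(** A combination of convergent forests is the binarisation of the combination
    of their preimages, which are convergent; as [bin] is injective, this is
    the only preimage. *)
Lemma lspan_convergent_bin (w : forest_alg R Nstar) :
  lspan convergentxy (bin w) <-> lspan convergentN w.
Proof.
split=> [[n [c [f [cvf E]]]]|]; last first.
  apply: (@lspan_linear _ _ _ _ _ (@bin R)) => F cvF.
  by rewrite /= binU; apply: lspanU; rewrite convergentxy_bin.
exists n, c, (fun i => cm_map tunbin (f i)).
have fK i : cm_map tbin (cm_map tunbin (f i)) = f i.
  by apply: cm_map_tunbinK; have /andP[] := cvf i.
split=> [i|]; first by rewrite -convergentxy_bin fK.
apply: bin_inj; rewrite E; apply/esym; apply: (etrans (linear_sum _ _ _ _)).
apply: eq_bigr => i _; apply: (etrans (binZ _ _)).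
by apply: (congr1 (GRing.scale _)); rewrite binU fK.
Qed.

(** * Single vertices and convergence *)

Lemma stuffle_single_tree n f :
  stuffle << single Nstar1 >> << ucm (bplus n f) >> =
    << ucm (bplus Nstar1 (ucm (bplus n f))) >>
    + (Bplus n (stuffle << single Nstar1 >> << f >>)
       + << ucm (bplus (Nstar_add Nstar1 n) f) >>) :> forest_alg R Nstar.
Proof.
apply: (etrans (shuffle_single_tree 1 Nstar_add Nstar1 n f)).
apply: (etrans (congr1 (+%R _) (scale1r _))); apply: esym; exact: addrA.
Qed.

Lemma shuffle0_single_tree l f :
  shuffle0 << single ly >> << ucm (bplus l f) >> =
    << ucm (bplus ly (ucm (bplus l f))) >>
    + Bplus l (shuffle0 << single ly >> << f >>) :> forest_alg R letter.
Proof.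
apply: (etrans (shuffle_single_tree 0 (fun a _ => a) ly l f)).
apply: (etrans (congr1 (+%R _) (scale0r _))); exact: addr0.
Qed.

(** The degree is recorded because a vertex x may be grafted onto a
    semiconvergent forest only if that forest is a single tree. *)
Definition semiconvergent_tree : pred (forest letter) :=
  [pred F | semiconvergent F && (mdeg F == 1)%N].

Lemma Bplus_semiconvergent (P : pred (forest letter)) l
    (u : forest_alg R letter) :
  (forall F, P F -> semiconvergent (ucm (bplus l F))) ->
  lspan P u -> lspan semiconvergent_tree (Bplus l u).
Proof.
move=> PS; apply: (@lspan_linear _ _ _ _ _ (Bplus l)) => F PF /=.
rewrite BplusU; apply: lspanU; apply/andP.
by split; [exact: PS | rewrite mdegU].
Qed.

(** The hypothesis on the trees of F makes this the inductive step from the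
    subtrees of a tree to the forest below its root. *)
Lemma shuffle0_single_semiconvergent_forest F :
  (forall T, T \in seq_of_cm F ->
     lspan semiconvergent_tree
       (shuffle0 << single ly >> << ucm T >> : forest_alg R letter)) ->
  semiconvergent F ->
  lspan semiconvergent (shuffle0 << single ly >> << F >> : forest_alg R letter).
Proof.
move=> IH scF; have [->|F1] := eqVneq F mone.
  rewrite /shuffle0 shuffleF1; apply: lspanU.
  by rewrite semiconvergent_bplus eqxx implybT /semiconvergent fvertices1.
rewrite /shuffle0 shuffle_single_forest //; apply/lspanZ/lspan_sum => T TF.
have /andP[_ scD] : semiconvergent (ucm T) && semiconvergent (divcm F (ucm T)).
  by rewrite -semiconvergentM divcmK.
apply: lspanMU (IH T TF) scD => G /andP[scG _] scD.
by rewrite semiconvergentM scG.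
Qed.

(** Grafting a new root y keeps any forest semiconvergent. A root x has exactly
    one child tree U, and by induction y * U is a combination of single trees,
    so grafting x back is still allowed. *)
Lemma shuffle0_single_semiconvergent_tree T : semiconvergent (ucm T) ->
  lspan semiconvergent_tree
    (shuffle0 << single ly >> << ucm T >> : forest_alg R letter).
Proof.
elim/rtree_ind: T => l F IH scT.
rewrite shuffle0_single_tree; apply: lspanD.
  apply: lspanU; apply/andP.
  by rewrite semiconvergent_bplus eqxx implybT scT mdegU.
move: scT; rewrite semiconvergent_bplus => /andP[lF scF].
have IHF T : T \in seq_of_cm F -> lspan semiconvergent_tree
    (shuffle0 << single ly >> << ucm T >> : forest_alg R letter).
  move=> TF; apply: IH => //.
  by move: scF; rewrite semiconvergentE => /allP; exact.
case: l lF => /= [|_]; last first.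
  apply: Bplus_semiconvergent (shuffle0_single_semiconvergent_forest IHF scF).
  by move=> G; rewrite semiconvergent_bplus eqxx implybT.
rewrite implybF negbK -size_seq_of_cm => F1.
have [U EF] : exists U, F = ucm U.
  rewrite -[F]seq_of_cmK; case: (seq_of_cm F) F1 => [|U []] // _.
  by exists U; rewrite /cm_of_seq big_seq1.
have {IHF} := IHF U; rewrite EF seq_of_cmU mem_head => /(_ isT).
apply: Bplus_semiconvergent => G /andP[scG /eqP G1].
by rewrite semiconvergent_bplus G1.
Qed.

Lemma shuffle0_single_semiconvergent F : semiconvergent F ->
  lspan semiconvergent (shuffle0 << single ly >> << F >> : forest_alg R letter).
Proof.
move=> scF; apply: shuffle0_single_semiconvergent_forest => // T TF.
apply: shuffle0_single_semiconvergent_tree.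
by move: scF; rewrite semiconvergentE => /allP; exact.
Qed.

(** B_y(tbin T) occurs on both sides and cancels; everything left has a root
    n or n + 1 before binarisation, or a root x. *)
Lemma single_tree_convergentxy n f : (2 <= val n)%N ->
  lspan convergentxy
    (bin (stuffle << single Nstar1 >> << ucm (bplus n f) >>)
     - shuffle0 << single ly >> << ucm (tbin (bplus n f)) >>
     : forest_alg R letter).
Proof.
move=> n2; set T := bplus n f.
have [T' ET] : exists T', tbin T = bplus lx (ucm T').
  by rewrite /T tbin_bplus; case: (val n) n2 => [|[|k]] //= _; eexists.
have scT' : semiconvergent (ucm T').
  have := semiconvergent_bin (ucm T).
  by rewrite cm_mapU ET semiconvergent_bplus => /andP[].
set w : forest_alg R Nstar := Bplus n (stuffle << single Nstar1 >> << f >>)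
  + << ucm (bplus (Nstar_add Nstar1 n) f) >>.
have -> : bin (stuffle << single Nstar1 >> << ucm T >>) =
    bin w + << ucm (bplus ly (ucm (tbin T))) >>.
  apply: (etrans (congr1 (@bin R) (stuffle_single_tree n f))).
  apply: (etrans (binD _ _)); apply: (etrans (addrC _ _)).
  apply: (congr1 (+%R (bin w))).
  by apply: (etrans (binU _ _)); rewrite cm_mapU tbin_bplus /= cm_mapU.
have -> : shuffle0 << single ly >> << ucm (tbin T) >> =
    << ucm (bplus ly (ucm (tbin T))) >>
    + Bplus lx (shuffle0 << single ly >> << ucm T' >>) :> forest_alg R letter.
  by rewrite ET; exact: shuffle0_single_tree.
rewrite addrKA; apply: lspanB.
  apply/lspan_convergent_bin/lspanD; last first.
    apply: lspanU; rewrite /convergentN seq_of_cmU /= troot_bplus andbT.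
    exact: ltnW.
  (* Whatever lies below it, a root n >= 2 gives a convergent forest. *)
  have [_ /(_ (fun _ _ => isT))] :=
    lspanP xpredT (stuffle << single Nstar1 >> << f >> : forest_alg R Nstar).
  apply: (@lspan_linear _ _ _ _ _ (Bplus n)) => G _ /=; rewrite BplusU.
  by apply: lspanU; rewrite /convergentN seq_of_cmU /= troot_bplus n2.
have := shuffle0_single_semiconvergent_tree scT'.
apply: (@lspan_linear _ _ _ _ _ (Bplus lx)) => G /andP[scG /eqP G1].
rewrite /= BplusU; apply: lspanU.
rewrite /convergentxy semiconvergent_bplus G1 scG.
by rewrite seq_of_cmU /= troot_bplus eqxx.
Qed.

Lemma single_convergentxy F : convergentN F ->
  lspan convergentxy
    (bin (stuffle << single Nstar1 >> << F >>)
     - shuffle0 << single ly >> (bin << F >>) : forest_alg R letter).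
Proof.
move=> cvF; have [->|F1] := eqVneq F mone.
  (* Both sides are the vertex y. *)
  rewrite binU cm_map1 /stuffle /shuffle0 !shuffleF1 binU cm_mapU tbin_bplus.
  by rewrite cm_map1 subrr; exact: lspan0.
have binF1 : cm_map tbin F != mone.
  by apply: contraNneq F1 => E; rewrite -mdeg_eq0 -mdeg_cm_map_tbin E mdeg1.
rewrite binU /stuffle /shuffle0 shuffle_single_forest // binZ.
rewrite shuffle_single_forest // mdeg_cm_map_tbin -scalerBr; apply: lspanZ.
rewrite [X in _ - X](perm_big _ (perm_seq_of_cm _)) big_map /=.
rewrite (linear_sum (@bin R)) -sumrB; apply: lspan_sum => T TF.
rewrite divcm_tbin // (rmorphM (@bin R)) /= binU -mulrBl.
have cvT : (2 <= val (troot T))%N by move/allP: cvF; exact.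
have := single_tree_convergentxy (tsub T) cvT; rewrite bplusK => cT.
have cD : convergentxy (cm_map tbin (divcm F (ucm T))).
  rewrite convergentxy_bin; move: cvF.
  by rewrite -{1}(divcmK TF) convergentNM => /andP[].
by apply: lspanMU cT cD => G cG; rewrite convergentxyM cG.
Qed.

End Proof.

Theorem propositionA6 (R : realType) (F : forest Nstar) :
  convergentN F ->
  let u : forest_alg R Nstar := stuffle << single Nstar1 >>%R << F >>%R in
  let v : forest_alg R letter :=
    shuffle0 << single ly >>%R (bin << F >>%R) in
  [/\ range (@bin R) v,
      lspan convergentN (u - bin_inv v)%R
    & lspan convergentxy (bin u - v)%R].
Proof.
move=> cvF u v; have cuv : lspan convergentxy (bin u - v)%R.
  exact: single_convergentxy.
have rv : range (@bin R) v.
  apply/range_bin; rewrite /v binU; apply: shuffle0_single_semiconvergent.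
  exact: semiconvergent_bin.
split=> //; apply/lspan_convergent_bin.
by rewrite (linearB (@bin R)) /= bin_invK.
Qed.
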